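(* Let $\Gamma:B\to B$ satisfy (a), (b), (c) of the context, and let $u(x,t)$ be the solution of the problem $u_t+u=\Gamma(u)$, $u|_{t=0}=u_0$, with $\|u_0\|\le1$. Let the spectral function $\mu(p)$ have its minimum (infimum) at $p=p_0$, the case $p_0=\infty$ being included. Assume that there exist $p\in(0,p_0)$ and $0<\varepsilon<p_0-p$ such that $$\int_0^1d\tau\,g_0(x\tau^{\mu(p)})=u_0(x)+O(x^{p+\varepsilon}),\qquad g_0=\Gamma(u_0).$$ Then: (i) there exists a unique solution $w(x)$ of the equation $\mu_*xw'(x)+w(x)=\Gamma(w)(x)$ with $\mu_*=\mu(p)$ such that $$\|w\|\le1,\qquad w(x)=u_0(x)+O(x^{p+\varepsilon});$$ (ii) $$\lim_{t\to\infty}u(xe^{-\mu(p)t},t)=w(x),\qquad x\ge0,$$ where the convergence is uniform on any bounded interval in $\mathbb{R}_+$, and $$u(xe^{-\mu(p)t},t)-w(x)=O\big(x^{p+\varepsilon}e^{-\beta(p,\varepsilon)t}\big),\qquad \beta(p,\varepsilon)=(p+\varepsilon)\big(\mu(p)-\mu(p+\varepsilon)\big)>0,$$ i.e. for some constant $C$ the absolute value of the left-hand side is at most $Cx^{p+\varepsilon}e^{-\beta(p,\varepsilon)t}$ for all $x\ge0$, $t\ge0$.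
   Context: $\mathbb{R}_+=[0,\infty)$; $B=C(\mathbb{R}_+)$ is the Banach space of bounded continuous real-valued functions on $\mathbb{R}_+$ with the sup norm; $U=\{u\in B:\|u\|\le1\}$. The conditions are: (a) $\Gamma(U)\subset U$. (b) $\Gamma$ is $L$-Lipschitz: for all $u_1,u_2\in U$ and all $x\ge0$, $|\Gamma(u_1)-\Gamma(u_2)|(x)\le L(|u_1-u_2|)(x)$, where $Lu(x)=\int_0^\infty da\,K(a)u(ax)$ and $K\ge0$ is a generalized function (i.e. $K(a)da$ is a finite nonnegative Borel measure on $\mathbb{R}_+$) such that $0<\lambda(p):=\int_0^\infty da\,K(a)a^p<\infty$ for all $p\ge0$. (c) $\Gamma$ is invariant under dilations: for every $\tau\in\mathbb{R}$, $\Gamma(u(e^\tau\,\cdot))=\Gamma(u)(e^\tau\,\cdot)$. The spectral function is $\mu(p)=(\lambda(p)-1)/p$, $p>0$. Standing assumption on the shape of $\mu$: $\mu(p)\to+\infty$ as $p\to0^+$, and either $\mu$ is strictly decreasing on $(0,\infty)$ (then $p_0=\infty$), or $\mu$ has a unique minimum point $p_0\in(0,\infty)$, is strictly decreasing on $(0,p_0)$ and increasing on $(p_0,\infty)$. The notation $y=O(x^q)$ means that there is a constant $C>0$ with $|y(x)|\le Cx^q$ for all $x\ge0$. A solution $w$ of $\mu_*xw'+w=\Gamma(w)$ is a function in $B$ which, if $\mu_*\neq0$, is continuously differentiable on $(0,\infty)$ and satisfies the equation for $x>0$ (if $\mu_*=0$ the equation reads $w=\Gamma(w)$). The solution $u(x,t)$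 of the Cauchy problem is the unique continuously differentiable map $t\mapsto u(\cdot,t)\in B$, $t\ge0$, with $\|u(\cdot,t)\|\le1$ satisfying the equation and the initial condition. *)

(* Defs.v *)
From HB Require Import structures.
From mathcomp Require Import all_boot all_order all_algebra.
From mathcomp Require Import all_classical all_reals all_analysis.

Set Implicit Arguments.
Unset Strict Implicit.
Unset Printing Implicit Defensive.

Import Order.TTheory GRing.Theory Num.Theory numFieldNormedType.Exports.

Local Open Scope classical_set_scope.
Local Open Scope ring_scope.

Section BoundedContinuous.
Variable R : realType.

Definition Rplus : set R := `[0, +oo[.

(* Functions on R_+ are represented by functions on R that vanish at negative
   arguments, so that Leibniz equality is equality on R_+. *)
Definition bcfun_set : set (R -> R) :=
  [set f | [/\ {within Rplus, continuous f},
               [bounded f x | x in Rplus]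
             & forall x, x < 0 -> f x = 0]].

Definition bcfun : {pred R -> R} := mem bcfun_set.

(* The space B = C(R_+) of bounded continuous functions on R_+. *)
Record bcType := BCFun { bcval :> R -> R ; bcvalP : bcval \in bcfun }.

HB.instance Definition _ := [isSub for bcval].
HB.instance Definition _ := [Choice of bcType by <:].

Lemma bcfunP (f : R -> R) : reflect (bcfun_set f) (f \in bcfun).
Proof. by apply: (iffP idP) => [/set_mem//|/mem_set]. Qed.

Lemma bounded_RplusP (f : R -> R) :
  [bounded f x | x in Rplus] <->
  exists M, forall x, 0 <= x -> `|f x| <= M.
Proof.
split=> [[M [_ fM]]|[M fM]].
  exists (M + 1) => x x0; apply: (fM (M + 1)); first by rewrite ltrDl.
  by rewrite /Rplus /= in_itv/= x0.
exists M; split; first exact: num_real.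
move=> y My x; rewrite /Rplus /= in_itv/= andbT => x0.
exact: le_trans (fM _ x0) (ltW My).
Qed.

Lemma bc_submod_closed : submod_closed bcfun.
Proof.
split.
  apply/bcfunP; split => //; first exact: cst_continuous.
  by apply/bounded_RplusP; exists 0 => x _; rewrite normr0.
move=> a f g /bcfunP[cf /bounded_RplusP[M fM] f0]
  /bcfunP[cg /bounded_RplusP[N gN] g0]; apply/bcfunP; split.
- move/subspace_continuousP : cf => cf; move/subspace_continuousP : cg => cg.
  apply/subspace_continuousP => x xR; apply: cvgD; last exact: cg.
  by apply: cvgZr; exact: cf.
- apply/bounded_RplusP; exists (`|a| * M + N) => x x0.
  apply: le_trans (ler_normD _ _) _; apply: lerD; last exact: gN.
  by rewrite normrM ler_wpM2l// fM.
- by move=> x x0; rewrite !fctE f0// g0// scaler0 addr0.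
Qed.

HB.instance Definition _ :=
  GRing.isSubmodClosed.Build R (R -> R) bcfun bc_submod_closed.
HB.instance Definition _ := [SubChoice_isSubLmodule of bcType by <:].

Lemma bcvalD (f g : bcType) x : (f + g) x = f x + g x.
Proof. by []. Qed.

Lemma bcvalN (f : bcType) x : (- f) x = - f x.
Proof. by []. Qed.

Lemma bcvalZ (a : R) (f : bcType) x : (a *: f) x = a * f x.
Proof. by []. Qed.

Lemma bc_ext (f g : bcType) : (forall x, 0 <= x -> f x = g x) -> f = g.
Proof.
move=> fg; apply/val_inj/funext => x /=.
have [x0|x0] := leP 0 x; first exact: fg.
have /bcfunP[_ _ f0] := bcvalP f; have /bcfunP[_ _ g0] := bcvalP g.
by rewrite f0// g0.
Qed.

Definition bcnorm (f : bcType) : R := sup [set `|f x| | x in Rplus].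

Lemma bcnorm_has_sup (f : bcType) : has_sup [set `|f x| | x in Rplus].
Proof.
split; first by exists `|f 0|, 0 => //; rewrite /Rplus /= in_itv/= lexx.
have /bcfunP[_ /bounded_RplusP[M fM] _] := bcvalP f.
exists M => _ [x xR <-]; apply: fM.
by move: xR; rewrite /Rplus /= in_itv/= andbT.
Qed.

Lemma bcnorm_ge (f : bcType) x : 0 <= x -> `|f x| <= bcnorm f.
Proof.
move=> x0; apply: (ub_le_sup (bcnorm_has_sup f).2); exists x => //.
by rewrite /Rplus /= in_itv/= x0.
Qed.

Lemma bcnorm_le (f : bcType) M :
  (forall x, 0 <= x -> `|f x| <= M) -> bcnorm f <= M.
Proof.
move=> fM; apply: (ge_sup (bcnorm_has_sup f).1) => _ [x xR <-].
by apply: fM; move: xR; rewrite /Rplus /= in_itv/= andbT.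
Qed.

Lemma bcnormD (f g : bcType) : bcnorm (f + g) <= bcnorm f + bcnorm g.
Proof.
apply: bcnorm_le => x x0; rewrite bcvalD.
by apply: le_trans (ler_normD _ _) _; apply: lerD; exact: bcnorm_ge.
Qed.

Lemma bcnormZ (a : R) (f : bcType) : bcnorm (a *: f) = `|a| * bcnorm f.
Proof.
have le b (g : bcType) : bcnorm (b *: g) <= `|b| * bcnorm g.
  by apply: bcnorm_le => x x0; rewrite bcvalZ normrM ler_wpM2l// bcnorm_ge.
apply/eqP; rewrite eq_le le/=.
have [->|a0] := eqVneq a 0.
  rewrite normr0 mul0r; exact: le_trans (normr_ge0 _) (bcnorm_ge _ (lexx 0)).
have := le a^-1 (a *: f); rewrite scalerA mulVf// scale1r normrV ?unitfE//.
by rewrite mulrC ler_pdivlMr ?normr_gt0// mulrC.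
Qed.

Lemma bcnorm0_eq0 (f : bcType) : bcnorm f = 0 -> f = 0.
Proof.
move=> f0; apply: bc_ext => x x0; apply/eqP.
by rewrite -normr_le0 -f0 bcnorm_ge.
Qed.

HB.instance Definition _ :=
  Lmodule_isNormed.Build R bcType bcnormD bcnormZ bcnorm0_eq0.

Lemma dilate_subproof (c : R) (u : bcType) :
  0 < c -> (fun x => u (c * x)) \in bcfun.
Proof.
move=> c0; have /bcfunP[cu /bounded_RplusP[M uM] u0] := bcvalP u.
apply/bcfunP; split.
- apply/subspace_continuousP => x; rewrite /Rplus/= in_itv/= andbT => x0.
  have cx0 : Rplus (c * x) by rewrite /Rplus/= in_itv/= mulr_ge0// ltW.
  move/subspace_continuousP : cu => /(_ _ cx0) {}cu.
  apply: cvg_trans cu; move=> A; rewrite !nbhs_simpl/= /within/= => wA.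
  have cxx : c * y @[y --> x] --> c * x by apply: cvgM => //; exact: cvg_cst.
  move: (cxx _ wA); rewrite !nbhs_simpl/=; apply: filterS => y /= yA y0.
  apply: yA; move: y0; rewrite /Rplus/= !in_itv/= !andbT => y0.
  by rewrite mulr_ge0// ltW.
- by apply/bounded_RplusP; exists M => x x0; rewrite uM// mulr_ge0// ltW.
- by move=> x x0; rewrite u0// nmulr_llt0.
Qed.

(* u(e^tau .) *)
Definition dilate (tau : R) (u : bcType) : bcType :=
  BCFun (dilate_subproof u (expR_gt0 tau)).

End BoundedContinuous.
Arguments Rplus R : clear implicits.

Section Setting.
Variable R : realType.
Local Notation B := (bcType R).

(* K stands for the measure K(a)da; only its restriction to R_+ is used. *)
Implicit Type K : {finite_measure set (measurableTypeR R) -> \bar R}.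

Definition Lop K (u : R -> R) (x : R) : R :=
  \int[K]_(a in Rplus R) u (a * x).

Definition lambda K (p : R) : \bar R :=
  (\int[K]_(a in Rplus R) (a `^ p)%:E)%E.

Definition mu K (p : R) : R := (fine (lambda K p) - 1) / p.

Definition spectral_shape K (p0 : \bar R) : Prop :=
  mu K p @[p --> 0^'+] --> +oo /\
  ((p0 = +oo%E /\ {in `]0, +oo[ &, {homo mu K : p q /~ p < q}})
   \/ exists2 r : R, p0 = r%:E &
      [/\ 0 < r,
          forall q, 0 < q -> q != r -> mu K r < mu K q,
          {in `]0, r[ &, {homo mu K : p q /~ p < q}}
        & {in `]r, +oo[ &, {homo mu K : p q / p <= q}}]).

Definition bigO_pow (q : R) (y : R -> R) : Prop :=
  exists2 C : R, 0 < C & forall x, 0 <= x -> `|y x| <= C * x `^ q.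

Definition maps_unit_ball (Gamma : B -> B) : Prop :=
  forall u, `|u| <= 1 -> `|Gamma u| <= 1.

Definition L_Lipschitz K (Gamma : B -> B) : Prop :=
  forall u1 u2 : B, `|u1| <= 1 -> `|u2| <= 1 -> forall x, 0 <= x ->
    `|Gamma u1 x - Gamma u2 x| <= Lop K (fun y => `|u1 y - u2 y|) x.

Definition dilation_invariant (Gamma : B -> B) : Prop :=
  forall (tau : R) (u : B), Gamma (dilate tau u) = dilate tau (Gamma u).

(* Derivative of a curve defined on the time interval [0, +oo[ (one-sided at
   t = 0); convergence is in the sup norm of B. *)
Definition is_derive_Rplus (u : R -> B) (t : R) (v : B) : Prop :=
  (s - t)^-1 *: (u s - u t) @[s --> within (Rplus R) t^'] --> v.

Definition cauchy_solution (Gamma : B -> B) (u0 : B) (u : R -> B) : Prop :=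
  [/\ u 0 = u0,
      forall t, 0 <= t -> `|u t| <= 1
    & exists u' : R -> B,
        [/\ forall t, 0 <= t -> is_derive_Rplus u t (u' t),
            {within Rplus R, continuous u'}
          & forall t, 0 <= t -> u' t + u t = Gamma (u t)]].

Definition profile_solution (Gamma : B -> B) (m : R) (w : B) : Prop :=
  (m = 0 -> w = Gamma w) /\
  (m <> 0 ->
    [/\ forall x, 0 < x -> derivable w x 1,
        forall x, 0 < x -> {for x, continuous (derive1 w)}
      & forall x, 0 < x -> m * x * derive1 w x + w x = Gamma w x]).

End Setting.

(* Main.v *)
Require Import Defs.
From mathcomp Require Import all_boot all_order all_algebra.
From mathcomp Require Import all_classical all_reals all_analysis.
From mathcomp Require Import measurable_realfun lebesgue_integral_under ring lra.

(* Write [q = p + eps], [m = mu(p)] and [v(x,t) = u(x e^{-mt}, t)].  The profile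
   equation is equivalent to [w = A (Gamma w)], where
   [A f (x) = int_0^1 f (x tau^m) dtau] is the bounded solution [g] of
   [m x g' + g = f].  In the weighted norm [sup |f(x)| / x^q] the map
   [A o Gamma] contracts with ratio [lambda(q) / (1 + q m)], which is less than 1
   because [mu(q) < mu(p)]; the hypothesis says that [u0] moves by a finite
   weighted distance, so the iterates of [u0] converge to the profile [w].
   If [w] is a profile then [w(x e^{mt})] solves the evolution equation pointwise,
   and two pointwise solutions at weighted distance [C] stay within
   [C x^q e^{(lambda(q) - 1) t}] of each other.  Rescaling [x] by [e^{-mt}] turns
   this into the rate [e^{-beta t}]; applied to [u] and [w] it gives (ii), applied
   to two profiles it gives uniqueness. *)

Set Implicit Arguments.
Unset Strict Implicit.
Unset Printing Implicit Defensive.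

Import Order.TTheory GRing.Theory Num.Theory numFieldNormedType.Exports.

Local Open Scope classical_set_scope.
Local Open Scope ring_scope.

(** * Comparison for scalar inequalities in [y' + y] *)

Section ScalarComparison.
Variable R : realType.
Implicit Types (y z P dy dz dP : R -> R) (a b : R).

(** The integrating factor [e^s] turns the hypothesis into monotonicity of [e^s z(s)]. *)
Lemma ge0_of_derive_add_ge0 z dz a b : a <= b ->
  {within `[a, b], continuous z} ->
  (forall s, a < s < b -> is_derive s 1 z (dz s)) ->
  (forall s, a < s < b -> 0 <= dz s + z s) ->
  0 <= z a -> 0 <= z b.
Proof.
move=> ab cz Dz dz0 za.
pose h s := expR s * z s.
have Dh s : a < s < b -> is_derive s 1 h (expR s * (dz s + z s)).
  move=> /Dz Dzs; apply: is_derive_eq.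
  by rewrite /GRing.scale/= mulrDr [z s * _]mulrC.
have : h a <= h b.
  apply: (@ger0_derive1_ndecr _ h a b) => //.
  - by move=> s; rewrite in_itv/= => /Dh ?; exact: ex_derive.
  - move=> s; rewrite in_itv/= => sab; have Dhs := Dh s sab.
    by rewrite derive1E derive_val mulr_ge0 ?expR_ge0// dz0.
  - apply/subspace_continuousP => s sab; apply: cvgM.
      by apply: cvg_within_filter; exact: continuous_expR.
    by move/subspace_continuousP : cz; apply.
move=> hab; rewrite -(pmulr_rge0 (z b) (expR_gt0 b)); apply: le_trans hab.
by rewrite mulr_ge0// expR_ge0.
Qed.

(** Positivity is applied to [P + y] and to [P - y]. The evolution equation and the profile equation
    along a dilation orbit both have left side [y' + y], so this one barrier argument serves for
    both. *)
Lemma norm_le_of_derive_add_le y dy P dP a b : a <= b ->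
  {within `[a, b], continuous y} ->
  (forall s, a < s < b -> is_derive s 1 y (dy s)) ->
  (forall s : R, is_derive s 1 P (dP s)) ->
  (forall s, a < s < b -> `|dy s + y s| <= dP s + P s) ->
  `|y a| <= P a -> `|y b| <= P b.
Proof.
move=> ab cy Dy DP yP.
have cP : {within `[a, b], continuous P}.
  apply: continuous_subspaceT => s; apply: differentiable_continuous.
  by apply/derivable1_diffP; have ? := DP s; exact: ex_derive.
rewrite !ler_norml => /andP[ya1 ya2]; apply/andP; split.
  rewrite -subr_ge0 opprK.
  apply: (@ge0_of_derive_add_ge0 (fun s => y s + P s) (fun s => dy s + dP s) a)
    => //.
  - by apply/subspace_continuousP => s sab; apply: cvgD;
      [move/subspace_continuousP : cy => /(_ s sab)
      |move/subspace_continuousP : cP => /(_ s sab)].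
  - by move=> s sab; have Dys := Dy s sab; exact: is_deriveD.
  - move=> s sab; have := yP s sab; rewrite ler_norml => /andP[+ _].
    by rewrite -subr_ge0 opprK => /le_trans; apply; lra.
  - by rewrite -[P a]opprK subr_ge0.
rewrite -subr_ge0.
apply: (@ge0_of_derive_add_ge0 (fun s => P s - y s) (fun s => dP s - dy s) a)
  => //.
- by apply/subspace_continuousP => s sab; apply: cvgB;
    [move/subspace_continuousP : cP => /(_ s sab)
      |move/subspace_continuousP : cy => /(_ s sab)].
- by move=> s sab; have Dys := Dy s sab; exact: is_deriveB.
- move=> s sab; have := yP s sab; rewrite ler_norml => /andP[_ +].
  by rewrite -subr_ge0 => /le_trans; apply; lra.
- by rewrite subr_ge0.
Qed.

End ScalarComparison.

(** * Elements of [B] as continuous functions *)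

Section BoundedContinuousFunctions.
Variable R : realType.
Implicit Types f g h : bcType R.

(* Elements of [bcType] jump to the junk value 0 on the negative half-line; their
   even extension is continuous on the whole line. *)
Lemma bc_continuous_abs f : continuous (fun x : R => f `|x|).
Proof.
have /bcfunP[/subspace_continuousP cf _ _] := bcvalP f.
move=> x; have /cf fx : Rplus R `|x| by rewrite /Rplus/= in_itv/= normr_ge0.
have nx : `|y| @[y --> x] --> `|x| by apply: cvg_norm; exact: cvg_id.
apply: cvg_trans fx; move=> A; rewrite !nbhs_simpl/= /within/= => wA.
move: (nx _ wA); rewrite !nbhs_simpl/=; apply: filterS => y /=.
by move=> yA; apply: yA; rewrite /Rplus/= in_itv/= normr_ge0.
Qed.

Lemma bc_continuous_at f x : 0 < x -> {for x, continuous f}.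
Proof.
move=> x0; have := @bc_continuous_abs f x; rewrite /continuous_at gtr0_norm//.
apply: cvg_trans; apply: near_eq_cvg; near=> y; rewrite ger0_norm//.
by apply: ltW; near: y; exact: lt_nbhsr.
Unshelve. all: end_near. Qed.

Lemma bc_of_continuous (k : R -> R) M : continuous k ->
  (forall x, 0 <= x -> `|k x| <= M) ->
  exists f, forall x, 0 <= x -> f x = k x.
Proof.
move=> ck kM.
pose k' (x : R) := if 0 <= x then k x else 0.
have k'E x : 0 <= x -> k' x = k x by rewrite /k' => ->.
suff kB : k' \in @bcfun R by exists (BCFun kB).
apply/bcfunP; split.
- apply/subspace_continuousP => x; rewrite /Rplus/= in_itv/= andbT => x0.
  rewrite /from_subspace/= k'E//.
  apply: (@cvg_trans _ (k @ within (Rplus R) (nbhs x))); last first.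
    by apply: cvg_within_filter; exact: ck.
  apply: near_eq_cvg; rewrite near_withinE; near=> y.
  by rewrite /Rplus/= in_itv/= andbT => y0; rewrite k'E.
- by apply/bounded_RplusP; exists M => x x0; rewrite k'E// kM.
- by move=> x; rewrite /k' leNgt => ->.
Unshelve. all: end_near. Qed.

Lemma bc_normP f M : 0 <= M ->
  `|f| <= M <-> (forall x, 0 <= x -> `|f x| <= M).
Proof.
move=> M0; split=> [fM x x0|]; last exact: bcnorm_le.
exact: le_trans (bcnorm_ge f x0) fM.
Qed.

(* The profile equation is only assumed for [x > 0], but the measure [K(a)da] may
   charge [a = 0], so that estimates are also needed at [x = 0]. *)
Lemma bc_bound_at0 f (q C c : R) : 0 < q ->
  (forall x, 0 < x -> `|f x| <= C * x `^ q + c) ->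
  forall x, 0 <= x -> `|f x| <= C * x `^ q + c.
Proof.
move=> q0 fP x; rewrite le_eqVlt => /predU1P[<-|]; last exact: fP.
have c1 : (`|f `|x| | : R) @[x --> (0:R)^'+] --> `|f 0|.
  apply: cvg_at_right_filter; apply: cvg_norm.
  by have := @bc_continuous_abs f 0; rewrite /continuous_at normr0.
have c2 : (C * x `^ q + c) @[x --> (0:R)^'+] --> C * 0 `^ q + c.
  apply: cvgD; last exact: cvg_cst.
  by apply: cvgM; [exact: cvg_cst|rewrite powR0 ?gt_eqF//; exact: powR_cvg0].
apply: (ler_cvg_to c1 c2); near=> y.
have y0 : 0 < y by near: y; exact: nbhs_right_gt.
by rewrite (gtr0_norm y0) fP.
Unshelve. all: end_near. Qed.

Lemma dilateE (tau : R) f x : dilate tau f x = f (expR tau * x).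
Proof. by []. Qed.

Lemma norm_dilate_le (tau : R) f : `|f| <= 1 -> `|dilate tau f| <= 1.
Proof.
move=> /(bc_normP _ ler01) f1; apply/bc_normP => // x x0.
by rewrite dilateE f1// mulr_ge0// expR_ge0.
Qed.

End BoundedContinuousFunctions.

(** * The operator [L] on powers *)

Section Lop.
Variable R : realType.
Variable K : {finite_measure set (measurableTypeR R) -> \bar R}.
Hypothesis lambda_fin : forall q : R, 0 <= q -> (0 < lambda K q < +oo)%E.
Local Notation lam q := (fine (lambda K q)).

Lemma lambda_ge0 q : 0 <= lam q.
Proof.
by apply: fine_ge0; apply: integral_ge0 => x _; rewrite lee_fin powR_ge0.
Qed.

Lemma measurable_Rplus : measurable (Rplus R : set (measurableTypeR R)).
Proof. exact: measurable_itv. Qed.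

Lemma powR_integrable q : 0 <= q ->
  K.-integrable (Rplus R) (fun a => (a `^ q)%:E).
Proof.
move=> q0; apply/integrableP; split.
  apply/measurable_EFinP; apply: measurable_funTS; exact: measurable_powR.
have /andP[_] := lambda_fin q0; apply: le_lt_trans; rewrite /lambda.
apply: ge0_le_integral; first exact: measurable_Rplus.
- by move=> x _; exact: abse_ge0.
- apply: measurableT_comp => //; apply/measurable_EFinP.
  by apply: measurable_funTS; exact: measurable_powR.
- apply/measurable_EFinP; apply: measurable_funTS; exact: measurable_powR.
- by move=> x _; rewrite /= ger0_norm// powR_ge0.
Qed.

(** Powers are eigenfunctions, [L x^q = lambda(q) x^q], and constants are the case [q = 0]. The
    constant term is there to carry the remainder of the later iteration. *)
Lemma Lop_le (u1 u2 : bcType R) (q C1 C2 : R) : 0 <= q ->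
  (forall y, 0 <= y -> `|u1 y - u2 y| <= C1 * y `^ q + C2) ->
  forall x, 0 <= x ->
  Lop K (fun y => `|u1 y - u2 y|) x <= C1 * lam q * x `^ q + C2 * lam 0.
Proof.
move=> q0 uC x x0.
(* Since [a^0 = 1] also at [a = 0], [lam 0] is the total mass on the half-line, a possible atom at 0
   included. *)
pose h a := C1 * x `^ q * a `^ q + C2 * a `^ 0.
have iZ c r : 0 <= r -> K.-integrable (Rplus R) (EFin \o (fun a => c * a `^ r)).
  move=> r0; rewrite (_ : _ \o _ = (fun a => c%:E * (a `^ r)%:E)%E).
    by apply: integrableZl; [exact: measurable_Rplus|exact: powR_integrable].
  by apply/funext => a /=; rewrite EFinM.
have ih : K.-integrable (Rplus R) (EFin \o h).
  rewrite (_ : EFin \o h = (EFin \o (fun a => C1 * x `^ q * a `^ q)) \+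
    (EFin \o (fun a => C2 * a `^ 0)))//.
  by apply: integrableD; [exact: measurable_Rplus|exact: iZ|exact: iZ].
have hE : \int[K]_(a in Rplus R) h a = C1 * lam q * x `^ q + C2 * lam 0.
  rewrite RintegralD; [|exact: measurable_Rplus|exact: iZ|exact: iZ].
  rewrite !RintegralZl; try exact: measurable_Rplus; try exact: powR_integrable.
  by rewrite /Rintegral -/(lambda K q) -/(lambda K 0); ring.
rewrite -hE; apply: le_Rintegral => //; first exact: measurable_Rplus.
  apply: (le_integrable _ _ _ ih); first exact: measurable_Rplus.
    apply/measurable_EFinP.
    (* The even extension makes the integrand continuous in [a] on the whole line, hence
       measurable. *)
    apply: (eq_measurable_fun
      ((fun a : R => `|u1 `|a * x| - u2 `|a * x| | : R)
        : measurableTypeR R -> R)).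
      by move=> a; rewrite inE /Rplus/= in_itv/= andbT => a0;
        rewrite (ger0_norm (mulr_ge0 a0 x0)).
    apply: measurable_funTS; apply: continuous_measurable_fun => a.
    have c (v : bcType R) : v `|y * x| @[y --> (a : R)] --> v `|a * x|.
      have ax : (y * x : R) @[y --> (a : R)] --> (a * x : R).
        by apply: cvgM; [exact: cvg_id|exact: cvg_cst].
      exact: (cvg_comp _ _ ax (@bc_continuous_abs _ v (a * x))).
    by apply: cvg_norm; apply: cvgB; exact: c.
  move=> a; rewrite /Rplus/= in_itv/= andbT => a0.
  rewrite lee_fin normr_id; apply: le_trans (ler_norm _).
  by apply: le_trans (uC _ _) _; rewrite ?mulr_ge0// powRM// /h powRr0 mulr1; lra.
move=> a; rewrite /Rplus/= in_itv/= andbT => a0.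
by apply: le_trans (uC _ _) _; rewrite ?mulr_ge0// powRM// /h powRr0 mulr1; lra.
Qed.

End Lop.

(** * Integrals of bounded functions and their scaling *)

Section IntegralScaling.
Variables (R : realType) (F : R -> R) (M : R).
Hypothesis mF : measurable_fun setT F.
Hypothesis FM : forall x, `|F x| <= M.
Hypothesis cF : forall x : R, 0 < x -> {for x, continuous F}.
Local Notation leb := (@lebesgue_measure R).

Lemma bounded_integrable_itv (a b : R) : leb.-integrable `[a, b] (EFin \o F).
Proof.
apply: measurable_bounded_integrable => //.
- by apply: compact_finite_measure; exact: segment_compact.
- exact: measurable_funTS.
- exists M; split; first exact: num_real.
  by move=> N MN x _; apply: le_trans (FM x) (ltW MN).
Qed.

Lemma norm_Rintegral_itv_le z : 0 <= z ->
  `|\int[leb]_(t in `[0, z]) F t| <= M * z.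
Proof.
move=> z0; apply: le_trans (le_normr_Rintegral _ _) _ => //.
  exact: bounded_integrable_itv.
have <- : \int[leb]_(t in `[0, z]) M = M * z.
  rewrite Rintegral_cst//= lebesgue_measure_itv/= lte_fin; move: z0;
    rewrite le_eqVlt => /predU1P[<-|->]; rewrite ?ltxx/= ?subr0 ?mulr0//.
apply: le_Rintegral => //.
- have := bounded_integrable_itv 0 z; exact: integrable_norm.
- apply: measurable_bounded_integrable => //.
  + by apply: compact_finite_measure; exact: segment_compact.
  + exists M; split; first exact: num_real.
    by move=> N MN x _ /=; apply: le_trans (ltW MN);
    rewrite ger0_norm//; exact: le_trans (normr_ge0 _) (FM 0).
Qed.

Lemma is_derive_integral_itv (z : R) : 0 < z ->
  is_derive z 1 (fun y => \int[leb]_(t in `[0, y]) F t) (F z).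
Proof.
move=> z0; have zz : z < z + 1 by rewrite ltrDl.
have [d e] := continuous_FTC1 zz (bounded_integrable_itv 0 (z + 1)) z0 (cF z0).
apply: DeriveDef; first exact: d.
by rewrite -derive1E; exact: e.
Qed.

End IntegralScaling.

(* [F] may oscillate at 0, which rules out the substitution lemmas of the library;
   instead both sides, as functions of the upper bound [z], have the same
   derivative for [z > 0] and vanish as [z] tends to 0. *)
Lemma Rintegral_scale (R : realType) (F : R -> R) (M c : R) :
  measurable_fun setT F -> (forall x, `|F x| <= M) ->
  (forall x : R, 0 < x -> {for x, continuous F}) -> 0 < c ->
  \int[lebesgue_measure]_(t in `[0, 1]) F (c * t) =
  c^-1 * \int[lebesgue_measure]_(t in `[0, c]) F t.
Proof.
move=> mF FM cF c0.
have M0 : 0 <= M := le_trans (normr_ge0 _) (FM 0).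
pose Fc t := F (c * t).
have mFc : measurable_fun setT Fc.
  by apply: measurableT_comp => //; exact: measurable_funM.
have cFc x : 0 < x -> {for x, continuous Fc}.
  move=> x0; have cx : (c * y : R) @[y --> (x : R)] --> (c * x : R).
    by apply: cvgM; [exact: cvg_cst|exact: cvg_id].
  exact: (cvg_comp _ _ cx (cF _ (mulr_gt0 c0 x0))).
pose D (z : R) := \int[lebesgue_measure]_(t in `[0, z]) Fc t -
  c^-1 * \int[lebesgue_measure]_(t in `[0, c * z]) F t.
have dD (z : R) : 0 < z -> is_derive z 1 D 0.
  move=> z0.
  have d1 := @is_derive_integral_itv _ Fc M mFc (fun x => FM _) cFc z z0.
  have d2 := @is_derive_integral_itv _ F M mF FM cF (c * z) (mulr_gt0 c0 z0).
  have d3 : is_derive z 1 (fun z : R => c * z) c.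
    by apply: is_derive_eq; rewrite /GRing.scale/= mulr1.
  have d4 := @is_derive1_comp _ _ _ _ _ _ d2 d3.
  have d5 := is_deriveB d1 (is_deriveZ c^-1 d4).
  apply: is_derive_eq.
  by rewrite /GRing.scale/= [_ * c]mulrC mulKf ?gt_eqF// subrr.
have DM (z : R) : 0 <= z -> `|D z| <= 2 * M * z.
  move=> z0; apply: le_trans (ler_normB _ _) _.
  have l1 := @norm_Rintegral_itv_le _ Fc M mFc (fun x => FM _) z z0.
  have l2 := @norm_Rintegral_itv_le _ F M mF FM (c * z) (mulr_ge0 (ltW c0) z0).
  have -> : 2 * M * z = M * z + c^-1 * (M * (c * z)).
    by rewrite mulrCA mulKf ?gt_eqF//; ring.
  by apply: lerD => //; rewrite normrM gtr0_norm ?invr_gt0// ler_pM2l ?invr_gt0.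
have D1 : D 1 = 0.
  apply/eqP; rewrite -normr_le0; apply/ler_addgt0Pr => e e0; rewrite add0r.
  (* For this [d] the bound [2 M d] on [D d] is at most [e]; the added 1 keeps the denominator
     positive when [M = 0]. *)
  pose d := Num.min 1 (e / (2 * M + 1)).
  have M1 : 0 < 2 * M + 1 by lra.
  have d0 : 0 < d by rewrite lt_min ltr01 divr_gt0.
  have d1 : d <= 1 by rewrite ge_min lexx.
  (* Used for [D] and for [- D], which together give [D d = D 1]. *)
  have mvt g : (forall z : R, 0 < z -> is_derive z 1 g (0 : R)) -> g d <= g 1.
    move=> dg; apply: (@ger0_derive1_ndecr _ g d 1) => //.
    - move=> x; rewrite in_itv/= => /andP[dx _].
      by have ? := dg x (lt_trans d0 dx); exact: ex_derive.
    - move=> x; rewrite in_itv/= => /andP[dx _].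
      by have ? := dg x (lt_trans d0 dx); rewrite derive1E derive_val.
    - apply: derivable_within_continuous => x; rewrite in_itv/= => /andP[dx _].
      by have ? := dg x (lt_le_trans d0 dx); exact: ex_derive.
  have -> : D 1 = D d.
    apply/eqP; rewrite eq_le mvt// andbT -lerN2.
    apply: (mvt (fun z => - D z)) => z z0; have ? := dD z z0.
    by apply: is_derive_eq; rewrite oppr0.
  apply: le_trans (DM _ (ltW d0)) _.
  apply: (@le_trans _ _ ((2 * M + 1) * d)).
    by rewrite ler_wpM2r ?(ltW d0)// lerDl.
  by rewrite mulrC -ler_pdivlMr// ge_min lexx orbT.
by move: D1; rewrite /D mulr1 => /eqP; rewrite subr_eq0 => /eqP.
Qed.

(** * The averaging operator [A] *)

Section Resolvent.
Variable R : realType.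
Local Notation leb := (@lebesgue_measure R).

(* With [x = z^m] the integral is [z^-1 * int_0^z f(s^m) ds], whose derivative in [z]
   gives the differential equation for either sign of [m]. *)
Lemma bc_resolvent_ex (m : R) (f : bcType R) : exists g : bcType R,
  [/\ forall x, 0 <= x ->
        g x = \int[lebesgue_measure]_(t in `[0, 1]) f (x * t `^ m),
      `|g| <= `|f| & profile_solution (fun=> f) m g].
Proof.
pose M : R := `|f|.
have fM y : 0 <= y -> `|f y| <= M by exact: bcnorm_ge.
pose k (x : R) := \int[leb]_(t in `[0, 1]) f `|x * t `^ m|.
have mpow (x : R) : measurable_fun setT (fun t : R => f `|x * t `^ m|).
  apply: (@measurableT_comp _ _ _ _ _ _ (fun y : R => f `|y|)).
    by apply: continuous_measurable_fun; exact: bc_continuous_abs.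
  by apply: measurable_funM => //; exact: measurable_powR.
have ipow (x : R) : leb.-integrable `[0, 1] (EFin \o (fun t => f `|x * t `^ m|)).
  by apply: (bounded_integrable_itv (M := M)) => // y; exact: fM.
have ck : continuous k.
  move=> x.
  apply: (@continuity_under_integral _ _ _ leb (fun x t => f `|x * t `^ m|) `[0, 1]
    _ (x - 1) (x + 1) _ _ (cst M)) => //.
  - apply: (@aeW _ _ _ lebesgue_measure) => t _ y _.
    have ty : (y * t `^ m : R) @[y --> (y : R)] --> (y * t `^ m : R).
      by apply: cvgM; [exact: cvg_id|exact: cvg_cst].
    exact: (cvg_comp _ _ ty (@bc_continuous_abs _ f (y * t `^ m))).
  - by apply: (bounded_integrable_itv (M := M)) => // y; rewrite ger0_norm.
  - by move=> y _; apply: (@aeW _ _ _ lebesgue_measure) => t _; apply: fM.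
  - by apply/mem_set; rewrite /= in_itv/=; lra.
have kM x : 0 <= x -> `|k x| <= M.
  move=> _.
  have := norm_Rintegral_itv_le (mpow x) (fun t => fM _ (normr_ge0 _)) ler01.
  by rewrite mulr1.
have [g gk] := bc_of_continuous ck kM; exists g; split.
- move=> x x0; rewrite gk//; apply: eq_Rintegral => t _.
  by rewrite ger0_norm// mulr_ge0// powR_ge0.
- by apply/bc_normP => // x x0; rewrite gk// kM.
split=> [m0|/eqP m0].
  (* Here [t^0 = 1] even at [t = 0], so the integrand is constant and [g = f]. *)
  apply: bc_ext => x x0; rewrite gk// /k m0.
  under eq_Rintegral do rewrite powRr0 mulr1 ger0_norm//.
  by rewrite Rintegral_cst//= lebesgue_measure_itv/= lte_fin ltr01/= subr0 mulr1.
pose F (s : R) := f `|s `^ m|.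
have mF : measurable_fun setT F.
  by have := mpow 1; under eq_fun do rewrite mul1r.
have FM s : `|F s| <= M by exact: fM.
have cF s : 0 < s -> {for s, continuous F}.
  move=> s0; have cs : (y `^ m : R) @[y --> (s : R)] --> (s `^ m : R).
    have ? := is_derive1_powR m s0.
    suff : {for s, continuous (fun y => y `^ m)} by [].
    by apply: differentiable_continuous; apply/derivable1_diffP; exact: ex_derive.
  exact: (cvg_comp _ _ cs (@bc_continuous_abs _ f (s `^ m))).
pose G (z : R) := \int[leb]_(t in `[0, z]) F t.
have gG (x : R) : 0 < x -> g x = (x `^ m^-1)^-1 * G (x `^ m^-1).
  move=> x0; rewrite gk ?ltW// -(Rintegral_scale mF FM cF) ?powR_gt0//.
  apply: eq_Rintegral => t; rewrite inE/= in_itv/= => /andP[t0 _].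
  by rewrite /F powRM ?powR_ge0// -powRrM mulVf// powRr1// ltW.
have dg (x : R) : 0 < x -> is_derive x 1 g ((f x - g x) / (m * x)).
  move=> x0; pose z (y : R) := y `^ m^-1.
  have z0 : 0 < z x by exact: powR_gt0.
  have dz : is_derive x 1 z (m^-1 * x `^ (m^-1 - 1)) by exact: is_derive1_powR.
  have dG : is_derive (z x) 1 G (F (z x)).
    exact: (@is_derive_integral_itv _ F M mF FM cF _ z0).
  have dGz := @is_derive1_comp _ _ _ _ _ _ dG dz.
  have zx0 : z x != 0 by rewrite gt_eqF.
  have dV := is_deriveV zx0 dz.
  have dP := is_deriveM dV dGz.
  have gE : \forall y \near x, ((fun y => (z y)^-1) * (G \o z)) y = g y.
    by near=> y; rewrite gG//; near: y; exact: lt_nbhsr.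
  have dP' := near_eq_is_derive gE dP.
  apply: is_derive_eq.
  have zE : x `^ (m^-1 - 1) = z x / x.
    have xx : x `^ 1 = x by rewrite powRr1// ltW.
    have -> : z x = x `^ (m^-1 - 1) * x.
      rewrite -{3}xx -powRD ?subrK//.
      by apply/implyP => _; rewrite gt_eqF.
    by rewrite mulfK// gt_eqF.
  have FE : F (z x) = f x.
    by rewrite /F -powRrM mulVf// powRr1 ?ltW// gtr0_norm.
  rewrite gG// zE FE /GRing.scale/= -/(z x); field.
  by rewrite m0/= !gt_eqF.
split.
- by move=> x x0; have ? := dg x x0; exact: ex_derive.
- move=> x x0.
  have dgE (y : R) : 0 < y -> derive1 g y = (f y - g y) / (m * y).
    by move=> y0; have ? := dg y y0; rewrite derive1E derive_val.
  apply: (@cvg_trans _ ((fun y : R => (f y - g y) / (m * y)) @ nbhs x)).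
    by apply: near_eq_cvg; near=> y; rewrite dgE//; near: y; exact: lt_nbhsr.
  rewrite dgE//; apply: cvgM.
    by apply: cvgB; exact: bc_continuous_at.
  apply: cvgV; first by rewrite mulf_neq0// gt_eqF.
  by apply: cvgM; [exact: cvg_cst|exact: cvg_id].
- move=> x x0; have ? := dg x x0; rewrite derive1E derive_val.
  by field; rewrite m0/= gt_eqF.
Unshelve. all: end_near. Qed.

End Resolvent.

(** * Dilation orbits and pointwise solutions *)

Section Orbits.
Variable R : realType.
Implicit Types (f g w : bcType R) (Gamma : bcType R -> bcType R).

(** Every barrier [P] below is such a sum: a main term plus a remainder. *)
Lemma is_derive_sum_expR (c1 k1 c2 k2 s : R) :
  is_derive s 1 (fun s => c1 * expR (k1 * s) + c2 * expR (k2 * s))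
    (k1 * (c1 * expR (k1 * s)) + k2 * (c2 * expR (k2 * s))).
Proof.
have dk (k : R) : is_derive s 1 (fun s : R => expR (k * s)) (k * expR (k * s)).
  have dl : is_derive s 1 (fun s : R => k * s) k.
    by apply: is_derive_eq; rewrite /GRing.scale/= mulr1.
  have := @is_derive1_comp _ expR ( *%R k) _ _ _ (is_derive_expR (k * s)) dl.
  by rewrite mulrC.
have d1 := is_deriveZ c1 (dk k1); have d2 := is_deriveZ c2 (dk k2).
have := is_deriveD d1 d2.
by rewrite /GRing.scale/= ![c1 * (_ * _)]mulrCA ![c2 * (_ * _)]mulrCA.
Qed.

Lemma powR_expR_mul (k x q : R) : 0 <= x ->
  (expR k * x) `^ q = x `^ q * expR (q * k).
Proof. by move=> x0; rewrite powRM ?expR_ge0// mulrC -expRM mulrC [k * q]mulrC mulrC. Qed.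

(** At [y = e^{ms} x] the chain rule gives [m y w'(y)], which the profile equation rewrites. For
    [m = 0] the orbit is constant and [w = Gamma w]. *)
Lemma is_derive_dilate Gamma m w (x s : R) : 0 < x ->
  profile_solution Gamma m w ->
  is_derive s 1 (fun s => dilate (m * s) w x)
    (dilate (m * s) (Gamma w) x - dilate (m * s) w x).
Proof.
move=> x0 [w0 w1].
have [m0|/eqP m0] := eqVneq m 0.
  rewrite -(w0 m0) subrr m0.
  rewrite (_ : (fun s => _) = cst (w x)).
    exact: is_derive_cst.
  by apply/funext => t; rewrite dilateE mul0r expR0 mul1r.
have [dw cw we] := w1 m0.
have ex0 : 0 < expR (m * s) * x by rewrite mulr_gt0 ?expR_gt0.
have de : is_derive s 1 (fun s : R => expR (m * s) * x) (m * (expR (m * s) * x)).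
  have := is_derive_sum_expR x m 0 0 s.
  rewrite (_ : (fun s => _) = (fun s : R => expR (m * s) * x)); last first.
    by apply/funext => t; rewrite mul0r addr0 mulrC.
  by rewrite !mul0r addr0 [x * _]mulrC.
have dw' : is_derive (expR (m * s) * x) 1 w (derive1 w (expR (m * s) * x)).
  by apply: DeriveDef; [exact: dw|rewrite derive1E].
have := @is_derive1_comp _ w (fun s => expR (m * s) * x) _ _ _ dw' de.
by rewrite [_ * (m * _)]mulrC !dilateE -we// addrK.
Qed.

(* The scalar comparison is run along the orbit [s |-> x e^{ms}] from [s = -T] to
   [s = 0]; the boundary term at [-T] is [O(e^{-T})] since [g1] and [g2] are bounded. *)
Lemma resolvent_le (f1 f2 g1 g2 : bcType R) (m q C : R) :
  0 < q -> 0 < 1 + q * m ->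
  profile_solution (fun=> f1) m g1 -> profile_solution (fun=> f2) m g2 ->
  (forall x, 0 <= x -> `|f1 x - f2 x| <= C * x `^ q) ->
  forall x, 0 <= x -> `|g1 x - g2 x| <= C / (1 + q * m) * x `^ q.
Proof.
move=> q0 qm s1 s2 fC.
suff gC x : 0 < x -> `|(g1 - g2) x| <= C / (1 + q * m) * x `^ q + 0.
  by move=> x x0; have := bc_bound_at0 q0 gC x0; rewrite addr0.
move=> x0; pose N : R := `|g1| + `|g2|.
have N0 : 0 <= N by rewrite addr_ge0.
apply/ler_addgt0Pr => e e0; pose T := N / e.
(* This [T] gives [N * expR (- T) <= e], because [N / e = T <= expR T]. *)
have T0 : 0 <= T by rewrite divr_ge0// ltW.
pose y s := dilate (m * s) g1 x - dilate (m * s) g2 x.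
pose c1 := C / (1 + q * m) * x `^ q.
(* The first term solves [P' + P = C x^q e^{qms}]; the second solves the homogeneous equation and
   equals [N] at [s = -T]. *)
pose P s := c1 * expR (q * m * s) + N * expR (- T) * expR (- 1 * s).
have dy (s : R) : is_derive s 1 y (dilate (m * s) f1 x - dilate (m * s) g1 x -
    (dilate (m * s) f2 x - dilate (m * s) g2 x)).
  have ? := is_derive_dilate s x0 s1; have ? := is_derive_dilate s x0 s2.
  exact: is_deriveB.
have := @norm_le_of_derive_add_le _ y _ P _ (- T) 0 _ _ (fun s _ => dy s)
  (is_derive_sum_expR _ _ _ _) _ _.
rewrite /y /P !mulr0 expR0 !mulr1 !dilateE expR0 !mul1r -/c1 addr0 => H.
apply: le_trans (H _ _ _ _) _.
- by rewrite oppr_le0.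
- by apply: derivable_within_continuous => s _; have ? := dy s; exact: ex_derive.
- move=> s _; rewrite !dilateE.
  set a := f1 _; set b := f2 _; set c := g1 _; set d := g2 _.
  rewrite (_ : a - c - (b - d) + (c - d) = a - b); last by ring.
  apply: le_trans (fC _ _) _; first by rewrite mulr_ge0 ?expR_ge0// ltW.
  rewrite (powR_expR_mul _ _ (ltW x0)) [q * (m * s)]mulrA.
  rewrite le_eqVlt; apply/orP; left; apply/eqP; rewrite /c1; field.
  by rewrite gt_eqF.
- rewrite -[leLHS]add0r lerD//.
    rewrite /c1 !mulr_ge0 ?expR_ge0 ?powR_ge0 ?invr_ge0 ?(ltW qm)//.
    by have := fC 1 ler01; rewrite powR1 mulr1; exact: le_trans.
  rewrite mulrN mulN1r opprK -mulrA -expRD addNr expR0 mulr1.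
  apply: le_trans (ler_normB _ _) _; rewrite lerD//; apply: bcnorm_ge;
    by rewrite mulr_ge0 ?expR_ge0// ltW.
rewrite lerD2l expRN ler_pdivrMr ?expR_gt0// mulrC -ler_pdivrMr// -/T.
by apply: le_trans (expR_ge1Dx T); rewrite lerDr.
Qed.

(* Solutions of [u_t + u = Gamma u] in the weak sense that is stable under the
   substitution [u(x,t) = w(x e^{mt})]: such a curve need not be differentiable
   for the sup norm. *)
Definition pointwise_solution Gamma (a : R -> bcType R) : Prop :=
  (forall t, 0 <= t -> `|a t| <= 1) /\
  forall x, 0 < x ->
    {within Rplus R, continuous (fun t => a t x)} /\
    forall t : R, 0 < t ->
      is_derive t 1 (fun t => a t x) (Gamma (a t) x - a t x).

(** Dilation invariance makes [Gamma] commute with the orbit, so the derivative along it is the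
    required right-hand side. *)
Lemma pointwise_solution_dilate Gamma m w :
  dilation_invariant Gamma -> profile_solution Gamma m w -> `|w| <= 1 ->
  pointwise_solution Gamma (fun t => dilate (m * t) w).
Proof.
move=> Gd sw w1; split=> [t _|x x0]; first exact: norm_dilate_le.
split=> [|t t0]; last by rewrite Gd; exact: is_derive_dilate.
apply: (@derivable_within_continuous _ _ _ `[0, +oo[) => s _.
by have ? := is_derive_dilate s x0 sw; exact: ex_derive.
Qed.

(** Multiplying out the difference quotient removes the puncture at [s = t]. *)
Lemma is_derive_Rplus_near (u : R -> bcType R) (t : R) v (e : R) : 0 < e ->
  is_derive_Rplus u t v -> \forall s \near t, 0 <= s ->
    `|u s - u t - (s - t) *: v| <= e * `|s - t|.
Proof.
move=> e0 /cvgrPdist_le/(_ _ e0).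
rewrite near_withinE => H.
have : \forall s \near t, s != t -> Rplus R s -> `|v - (s - t)^-1 *: (u s - u t)| <= e.
  exact: H.
apply: filterS => s sH s0.
have [->|st] := eqVneq s t; first by rewrite !subrr scale0r subrr !normr0 mulr0.
have st0 : s - t != 0 by rewrite subr_eq0.
have /(_ st) := sH; rewrite /Rplus/= in_itv/= andbT => /(_ s0).
rewrite -normrN opprB => sH'.
have -> : u s - u t - (s - t) *: v = (s - t) *: ((s - t)^-1 *: (u s - u t) - v).
  by rewrite scalerBr scalerA mulfV// scale1r.
by rewrite normrZ mulrC ler_wpM2r.
Qed.

(** Evaluation at [x] is dominated by the sup norm, so the first-order expansion in [B] passes to
    each fixed [x]. *)
Lemma cauchy_solution_pointwise Gamma u0 u :
  cauchy_solution Gamma u0 u -> pointwise_solution Gamma u.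
Proof.
move=> [_ u1 [u' [du _ ue]]]; split => // x x0.
have near_x (t e : R) : 0 <= t -> 0 < e -> \forall s \near t, 0 <= s ->
    `|u s x - u t x - (s - t) * u' t x| <= e * `|s - t|.
  move=> t0 e0; have := is_derive_Rplus_near e0 (du t t0).
  apply: filterS => s /[apply]; apply: le_trans.
  exact: (bcnorm_ge (u s - u t - (s - t) *: u' t) (ltW x0)).
split.
  apply/subspace_continuousP => t; rewrite /Rplus/= in_itv/= andbT => t0.
  apply/cvgrPdist_le => e e0; rewrite near_withinE.
  (* The expansion with tolerance 1 bounds the increment by [1 + |u' t x|] times [|s - t|]. *)
  have N0 : 0 < 1 + `|u' t x| by rewrite ltr_pwDl.
  near=> s; rewrite /Rplus/= in_itv/= andbT => s0.
  rewrite /from_subspace/= distrC.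
  have H : `|u s x - u t x - (s - t) * u' t x| <= 1 * `|s - t|.
    by move: s0; near: s; exact: near_x.
  have st : `|s - t| <= e / (1 + `|u' t x|).
    near: s; have := @cvg_id _ (nbhs t).
    by move/cvgrPdist_le => /(_ (e / (1 + `|u' t x|)) (divr_gt0 e0 N0));
      apply: filterS => s; rewrite distrC.
  rewrite -[u s x - u t x](subrK ((s - t) * u' t x)).
  apply: le_trans (ler_normD _ _) _; rewrite normrM.
  apply: le_trans (lerD H (lexx _)) _.
  by rewrite [1 * _]mulrC -mulrDr -ler_pdivlMr.
move=> t t0.
have -> : Gamma (u t) x - u t x = u' t x.
  by rewrite -ue ?ltW// bcvalD addrK.
have cq : h^-1 *: ((fun t => u t x) (h *: 1 + t) - u t x) @[h --> 0^'] --> (u' t x : R).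
  apply/cvgrPdist_le => e e0.
  have := near_x t e (ltW t0) e0.
  have t0' : \forall s \near t, 0 <= s.
    by near=> s; apply: ltW; near: s; exact: lt_nbhsr.
  move=> H; have {H} : \forall s \near t, `|u s x - u t x - (s - t) * u' t x| <= e * `|s - t|.
    by apply: filterS2 H t0' => s; exact.
  rewrite (near_shift (0 : R) t) subr0 near_withinE.
  apply: filterS => h /= H' h0; rewrite addrK in H'.
  rewrite /GRing.scale/= mulr1 distrC.
  rewrite (_ : _ - u' t x = h^-1 * (u (h + t) x - u t x - h * u' t x)); last first.
    by rewrite [RHS]mulrBr mulKf.
  by rewrite normrM normfV ler_pdivrMl ?normr_gt0// [leRHS]mulrC.
by apply: DeriveDef; [apply/cvg_ex; exists (u' t x)|exact: cvg_lim].
Unshelve. all: end_near. Qed.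

End Orbits.

(** * Weighted comparison of two evolutions *)

Section Comparison.
Variable R : realType.
Variable K : {finite_measure set (measurableTypeR R) -> \bar R}.
Hypothesis lambda_fin : forall q : R, 0 <= q -> (0 < lambda K q < +oo)%E.
Variable Gamma : bcType R -> bcType R.
Hypothesis Gamma_Lip : L_Lipschitz K Gamma.
Local Notation lam q := (fine (lambda K q)).

Lemma Gamma_le (u1 u2 : bcType R) (q C1 C2 : R) : `|u1| <= 1 -> `|u2| <= 1 -> 0 <= q ->
  (forall y, 0 <= y -> `|u1 y - u2 y| <= C1 * y `^ q + C2) ->
  forall x, 0 <= x ->
  `|Gamma u1 x - Gamma u2 x| <= C1 * lam q * x `^ q + C2 * lam 0.
Proof.
move=> u11 u21 q0 uC x x0; apply: le_trans (Gamma_Lip u11 u21 x0) _.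
exact: Lop_le.
Qed.

(* [x^q e^{(lambda(q)-1)t}] solves [v_t + v = L v]; the error term comes from
   iterating the crude bound [|a - b| <= 2] and tends to zero with [n]. *)
Lemma comparison_iter (a b : R -> bcType R) (q C : R) n :
  pointwise_solution Gamma a -> pointwise_solution Gamma b -> 0 < q ->
  (forall x, 0 <= x -> `|a 0 x - b 0 x| <= C * x `^ q) ->
  forall x t, 0 <= x -> 0 <= t -> `|a t x - b t x| <=
    C * expR ((lam q - 1) * t) * x `^ q
    + 2 * (lam 0 / (lam 0 + 1)) ^+ n * expR (lam 0 * t).
Proof.
move=> [a1 aD] [b1 bD] q0 abC.
have C0 : 0 <= C by have := abC 1 ler01; rewrite powR1 mulr1; exact: le_trans.
have l0 := @lambda_ge0 _ K 0.
elim: n => [|n IH] x t x0 t0.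
  rewrite -[leLHS]add0r lerD//; first by rewrite !mulr_ge0 ?expR_ge0 ?powR_ge0.
  rewrite expr0 mulr1; apply: (@le_trans _ _ 2).
    apply: le_trans (ler_normB _ _) _.
    by apply: (@lerD _ _ 1 _ 1); apply: le_trans (bcnorm_ge _ x0) _; [exact: a1|exact: b1].
  by rewrite ler_peMr// -expR0 ler_expR mulr_ge0.
suff {x x0} abx x : 0 < x -> `|(a t - b t) x| <=
    C * expR ((lam q - 1) * t) * x `^ q
    + 2 * (lam 0 / (lam 0 + 1)) ^+ n.+1 * expR (lam 0 * t).
  exact: (bc_bound_at0 q0 abx x0).
move=> x0; have [ca da] := aD x x0; have [cb db] := bD x x0.
pose c := 2 * (lam 0 / (lam 0 + 1)) ^+ n.
pose y s := a s x - b s x.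
have dy s : 0 < s < t -> is_derive s 1 y
    (Gamma (a s) x - a s x - (Gamma (b s) x - b s x)).
  by move=> /andP[s0 _]; have ? := da s s0; have ? := db s s0; exact: is_deriveB.
(* Chosen so that [P' + P] equals the bound [Gamma_le] extracts from the induction hypothesis. For
   the remainder [e^{lam 0 s}] this means dividing by [lam 0 + 1], the source of the ratio
   [lam 0 / (lam 0 + 1)]. *)
pose P s := C * x `^ q * expR ((lam q - 1) * s)
  + c * (lam 0 / (lam 0 + 1)) * expR (lam 0 * s).
rewrite [leRHS](_ : _ = P t); last by rewrite /P /c exprSr; ring.
apply: (@norm_le_of_derive_add_le _ y _ P _ 0 t t0 _ dy
  (is_derive_sum_expR _ _ _ _)).
- apply: (@continuous_subspaceW _ _ _ (Rplus R)).
    by move=> s; rewrite /Rplus/= !in_itv/= => /andP[-> _].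
  apply/subspace_continuousP => s s0.
  by apply: cvgB; [move/subspace_continuousP : ca => /(_ s s0)|
    move/subspace_continuousP : cb => /(_ s s0)].
- move=> s /andP[s0 _].
  rewrite (_ : _ - _ - _ + _ = Gamma (a s) x - Gamma (b s) x); last by rewrite /y; ring.
  have := Gamma_le (a1 _ (ltW s0)) (b1 _ (ltW s0)) (ltW q0)
    (fun y y0 => IH y s y0 (ltW s0)) (ltW x0).
  move/le_trans; apply; rewrite le_eqVlt; apply/orP; left; apply/eqP.
  by rewrite /P -/c; field; rewrite gt_eqF// ltr_wpDl.
- rewrite /y /P !mulr0 expR0 !mulr1 -[leLHS]addr0 lerD ?abC ?(ltW x0)//.
  have r0 : 0 <= lam 0 / (lam 0 + 1) by rewrite divr_ge0// addr_ge0.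
  by rewrite mulr_ge0// mulr_ge0// exprn_ge0.
Qed.

Lemma comparison (a b : R -> bcType R) (q C : R) :
  pointwise_solution Gamma a -> pointwise_solution Gamma b -> 0 < q ->
  (forall x, 0 <= x -> `|a 0 x - b 0 x| <= C * x `^ q) ->
  forall x t, 0 <= x -> 0 <= t ->
  `|a t x - b t x| <= C * expR ((lam q - 1) * t) * x `^ q.
Proof.
move=> sa sb q0 abC x t x0 t0.
have l0 := @lambda_ge0 _ K 0.
set A := (X in _ <= X); pose r := lam 0 / (lam 0 + 1).
have r1 : `|r| < 1.
  rewrite ger0_norm; last by rewrite divr_ge0// addr_ge0.
  by rewrite ltr_pdivrMr ?mul1r ?ltrDl// ltr_wpDl.
have c1 : A + 2 * r ^+ n * expR (lam 0 * t) @[n --> \oo] --> A + 2 * 0 * expR (lam 0 * t).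
  apply: cvgD; first exact: cvg_cst.
  apply: cvgM; last exact: cvg_cst.
  by apply: cvgM; [exact: cvg_cst|exact: cvg_expr].
rewrite mulr0 mul0r addr0 in c1.
apply: (ler_cvg_to (cvg_cst _) c1); apply: nearW => n.
exact: comparison_iter.
Qed.

End Comparison.

(** * Geometric and exponential decay *)

Section GeometricSequences.
Variable R : realType.

(** With [d = c / (1 - r)] one has [d r^n - d r^{n+1} = c r^n], so [v n + d r^n] decreases and
    [v n - d r^n] increases. Their common limit yields convergence and the error bound at once. *)
Lemma geometric_cvg (v : R^nat) (c r : R) : 0 <= r < 1 ->
  (forall n, `|v n.+1 - v n| <= c * r ^+ n) ->
  exists l, v n @[n --> \oo] --> l /\ forall n, `|l - v n| <= c / (1 - r) * r ^+ n.
Proof.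
move=> /andP[r0 r1] vc; set d := c / (1 - r).
have c0 : 0 <= c by have := vc 0; rewrite mulr1; exact: le_trans.
have r10 : 0 < 1 - r by rewrite subr_gt0.
have d0 : 0 <= d by rewrite divr_ge0// ltW.
have dr n : d * r ^+ n - d * r ^+ n.+1 = c * r ^+ n.
  by rewrite exprS /d; field; rewrite gt_eqF.
have drn0 : d * r ^+ n @[n --> \oo] --> 0.
  by rewrite -(mulr0 d); apply: cvgM; [exact: cvg_cst|apply: cvg_expr; rewrite ger0_norm].
pose V n := v n + d * r ^+ n; pose U n := v n - d * r ^+ n.
have Vdec : nonincreasing_seq V.
  apply/nonincreasing_seqP => n; rewrite /V -subr_ge0.
  have := dr n; have := vc n; rewrite ler_norml => /andP[_]; lra.
have Uinc : nondecreasing_seq U.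
  apply/nondecreasing_seqP => n; rewrite /U -subr_ge0.
  have := dr n; have := vc n; rewrite ler_norml => /andP[+ _]; lra.
have UV n : U n <= V n.
  by rewrite /U /V; have : 0 <= d * r ^+ n by [rewrite mulr_ge0// exprn_ge0]; lra.
have cV : cvgn V.
  apply: nonincreasing_is_cvgn => //; exists (U 0) => _ [n _ <-].
  by apply: le_trans (UV n); exact: Uinc.
have Vv : V n - d * r ^+ n @[n --> \oo] --> limn V - 0 by apply: cvgB.
have vE : (fun n => V n - d * r ^+ n) = v by apply/funext => n; rewrite /V addrK.
rewrite subr0 vE in Vv.
have Uv : U n @[n --> \oo] --> limn V - 0 by apply: cvgB.
rewrite subr0 in Uv.
exists (limn V); split=> // n; rewrite ler_norml; apply/andP; split.
  have := nondecreasing_cvgn_le Uinc (cvgP _ Uv) n.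
  by rewrite (cvg_lim _ Uv)// /U; lra.
by have := nonincreasing_cvgn_ge Vdec cV n; rewrite /V; lra.
Qed.

Lemma geometric_small (c r e : R) : 0 <= r < 1 -> 0 < e ->
  exists n, c * r ^+ n <= e.
Proof.
move=> /andP[r0 r1] e0.
have c0 : c * r ^+ n @[n --> \oo] --> 0.
  by rewrite -(mulr0 c); apply: cvgM; [exact: cvg_cst|apply: cvg_expr; rewrite ger0_norm].
have /cvgrPdist_le/(_ _ e0) [N _ H] := c0.
by exists N; have := H N (leqnn N); rewrite sub0r normrN; apply: le_trans (ler_norm _).
Qed.

Lemma expR_small (c b e : R) : 0 < b -> 0 < e ->
  \forall t \near +oo, 0 <= t /\ c * expR (- b * t) <= e.
Proof.
move=> b0 e0; near=> t.
have t0 : 0 <= t by near: t; exact: nbhs_pinfty_ge.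
split=> //; rewrite mulNr expRN ler_pdivrMr ?expR_gt0// mulrC -ler_pdivrMr//.
apply: le_trans (expR_ge1Dx _).
have : c / e / b <= t by near: t; apply: nbhs_pinfty_ge; exact: num_real.
by rewrite ler_pdivrMr// mulrC; lra.
Unshelve. all: end_near. Qed.

End GeometricSequences.

(** * Construction of the profile and rescaled comparison *)

Section Profile.
Variable R : realType.
Variable K : {finite_measure set (measurableTypeR R) -> \bar R}.
Hypothesis lambda_fin : forall q : R, 0 <= q -> (0 < lambda K q < +oo)%E.
Variable Gamma : bcType R -> bcType R.
Hypothesis Gamma_ball : maps_unit_ball Gamma.
Hypothesis Gamma_Lip : L_Lipschitz K Gamma.
Local Notation lam q := (fine (lambda K q)).

(** The weighted distance may be infinite between elements of [B], so the limit of the iterates is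
    taken pointwise; its continuity and the fixed-point equation are then checked directly. *)
Lemma profile_ex (u0 : bcType R) (m q : R) : `|u0| <= 1 -> 0 < q ->
  lam q < 1 + q * m ->
  bigO_pow q (fun x =>
    \int[lebesgue_measure]_(tau in `[0, 1]) Gamma u0 (x * tau `^ m) - u0 x) ->
  exists w : bcType R, [/\ profile_solution Gamma m w, `|w| <= 1
    & bigO_pow q (fun x => w x - u0 x)].
Proof.
move=> u01 q0 lamq [C C0 hint].
have l0 : 0 <= lam q by exact: lambda_ge0.
have qm : 0 < 1 + q * m by exact: le_lt_trans lamq.
have [A AP] := choice (fun f => bc_resolvent_ex m f).
pose r := lam q / (1 + q * m).
have r01 : 0 <= r < 1 by rewrite divr_ge0 ?(ltW qm)//= ltr_pdivrMr// mul1r.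
have /andP[r0 r1] := r01.
pose W n := iter n (A \o Gamma) u0.
have W1 n : `|W n| <= 1.
  elim: n => //= n IH; have [_ + _] := AP (Gamma (W n)).
  by move/le_trans; apply; exact: Gamma_ball.
have AG_le (u1 u2 : bcType R) c : `|u1| <= 1 -> `|u2| <= 1 ->
    (forall y, 0 <= y -> `|u1 y - u2 y| <= c * y `^ q) ->
    forall x, 0 <= x -> `|A (Gamma u1) x - A (Gamma u2) x| <= c * r * x `^ q.
  move=> u11 u21 uc x x0.
  have [_ _ s1] := AP (Gamma u1); have [_ _ s2] := AP (Gamma u2).
  rewrite /r mulrA; apply: (resolvent_le q0 qm s1 s2) => // y y0.
  have := Gamma_le lambda_fin Gamma_Lip (C1 := c) (C2 := 0) u11 u21 (ltW q0).
  by move=> /(_ _ y y0); rewrite mul0r addr0; apply => z z0; rewrite addr0 uc.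
have WC n x : 0 <= x -> `|W n.+1 x - W n x| <= C * r ^+ n * x `^ q.
  elim: n x => [|n IH] x x0; last first.
    by rewrite exprSr [C * _]mulrA; apply: (AG_le _ _ _ (W1 n.+1) (W1 n)).
  have [AE _ _] := AP (Gamma u0).
  by rewrite [W 1](_ : _ = A (Gamma u0))// AE// expr0 mulr1; exact: hint.
pose d := C / (1 - r).
have d0 : 0 < d by rewrite divr_gt0// subr_gt0.
(* Limits are taken at [|x|], so that continuity of the limit can be proved on the whole line. *)
have lim_ex (x : R) : exists l : R, W n `|x| @[n --> \oo] --> l /\
    forall n, `|l - W n `|x| | <= d * `|x| `^ q * r ^+ n.
  have Wx n : `|W n.+1 `|x| - W n `|x| | <= C * `|x| `^ q * r ^+ n.
    by rewrite mulrAC WC.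
  have [l [cl ld]] := geometric_cvg r01 Wx.
  by exists l; split=> // n; rewrite /d [C / _ * _]mulrAC ld.
have [k kP] := choice lim_ex.
have kW x n : `|k x - W n `|x| | <= d * `|x| `^ q * r ^+ n by have [_] := kP x.
have ck : continuous k.
  move=> x; apply/cvgrPdist_le => e e0.
  have e30 : 0 < e / 3 by rewrite divr_gt0.
  (* The weight [|y|^q] is unbounded, but [c] controls it for [|y| <= |x| + 1]: the iterates
     converge locally uniformly. *)
  pose c := d * (`|x| + 1) `^ q.
  have [n cn] := geometric_small c r01 e30.
  have kWn y : `|y| <= `|x| + 1 -> `|k y - W n `|y| | <= e / 3.
    move=> yx; apply: le_trans (kW y n) _; apply: le_trans cn.
    rewrite ler_wpM2r ?exprn_ge0// ler_wpM2l ?(ltW d0)//.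
    by rewrite ge0_ler_powR ?(ltW q0)// nnegrE// addr_ge0.
  have /cvgrPdist_le/(_ _ e30) cW := @bc_continuous_abs _ (W n) x.
  near=> y.
  have yx : `|y| <= `|x| + 1.
    have : `|x - y| <= 1.
      by near: y; move/cvgrPdist_le : (@cvg_id _ (nbhs x)); exact.
    have := le_trans (ler_norm _) (ler_dist_dist y x); rewrite distrC; lra.
  have h1 := kWn x; have h2 := kWn y yx.
  have h3 : `|W n `|x| - W n `|y| | <= e / 3 by near: y; exact: cW.
  rewrite (_ : k x - k y = (k x - W n `|x|) + (W n `|x| - W n `|y|) - (k y - W n `|y|));
    last by ring.
  apply: le_trans (ler_normB _ _) _; apply: le_trans (lerD (ler_normD _ _) (lexx _)) _.
  have {}h1 := h1 _; have : `|x| <= `|x| + 1 by rewrite lerDl.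
  by move=> /h1; lra.
have k1 x : 0 <= x -> `|k x| <= 1.
  move=> x0; have [/cvg_norm cW _] := kP x.
  apply: (ler_cvg_to cW (cvg_cst _)); apply: nearW => n.
  exact: le_trans (bcnorm_ge _ (normr_ge0 x)) (W1 n).
have [w wk] := bc_of_continuous ck k1.
have w1 : `|w| <= 1 by apply/bc_normP => // x x0; rewrite wk// k1.
have wW n x : 0 <= x -> `|w x - W n x| <= d * r ^+ n * x `^ q.
  by move=> x0; have := kW x n; rewrite (ger0_norm x0) -wk// mulrAC.
have wE : A (Gamma w) = w.
  apply: bc_ext => x x0; apply/eqP; rewrite -subr_eq0 -normr_le0.
  apply/ler_addgt0Pr => e e0; rewrite add0r.
  (* Both [A (Gamma w)] and [w] lie within [d r^{n+1} x^q] of [W n.+1], whence the factor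
     [2 d r]. *)
  have [n /(le_trans _)] := geometric_small (2 * d * r * x `^ q) r01 e0; apply.
  rewrite (_ : A (Gamma w) x - w x = (A (Gamma w) x - W n.+1 x) - (w x - W n.+1 x));
    last by ring.
  apply: le_trans (ler_normB _ _) _.
  have h1 := AG_le _ _ _ w1 (W1 n) (wW n) x x0.
  by have h2 := wW n.+1 x x0; apply: le_trans (lerD h1 h2) _; rewrite exprSr; lra.
exists w; split => //.
- by have [_ _] := AP (Gamma w); rewrite wE.
- by exists d => // x x0; have := wW 0 x x0; rewrite expr0 mulr1.
Unshelve. all: end_near. Qed.

(* [beta = q m + 1 - lambda(q)] *)
Lemma comparison_rescaled (a b : R -> bcType R) (m q C : R) :
  pointwise_solution Gamma a -> pointwise_solution Gamma b -> 0 < q ->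
  (forall x, 0 <= x -> `|a 0 x - b 0 x| <= C * x `^ q) ->
  forall x t, 0 <= x -> 0 <= t ->
  `|a t (x * expR (- m * t)) - b t (x * expR (- m * t))|
    <= C * (x `^ q * expR (- (q * (m - mu K q)) * t)).
Proof.
move=> sa sb q0 abC x t x0 t0.
have := comparison lambda_fin Gamma_Lip sa sb q0 abC.
move=> /(_ (x * expR (- m * t)) t (mulr_ge0 x0 (expR_ge0 _)) t0)/le_trans; apply.
rewrite [x * _]mulrC powR_expR_mul//.
have -> : - (q * (m - mu K q)) * t = (lam q - 1) * t + q * (- m * t).
  by rewrite /mu; field; rewrite gt_eqF.
by rewrite expRD le_eqVlt; apply/orP; left; apply/eqP; ring.
Qed.

End Profile.

(** * Existence, uniqueness and convergence to the profile *)

Theorem theorem7p2 (R : realType)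
  (K : {finite_measure set (measurableTypeR R) -> \bar R})
  (hlambda : forall q : R, 0 <= q -> (0 < lambda K q < +oo)%E)
  (p0 : \bar R) (hmu : spectral_shape K p0)
  (Gamma : bcType R -> bcType R)
  (ha : maps_unit_ball Gamma)
  (hb : L_Lipschitz K Gamma)
  (hc : dilation_invariant Gamma)
  (u0 : bcType R) (hu0 : `|u0| <= 1)
  (u : R -> bcType R) (hu : cauchy_solution Gamma u0 u)
  (p eps : R) (hp : 0 < p) (hpp0 : (p%:E < p0)%E)
  (heps : 0 < eps) (hepsp0 : (eps%:E < p0 - p%:E)%E)
  (hint : bigO_pow (p + eps) (fun x =>
    \int[lebesgue_measure]_(tau in `[0, 1]) Gamma u0 (x * tau `^ mu K p)
      - u0 x)) :
  let beta := (p + eps) * (mu K p - mu K (p + eps)) in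
  exists w : bcType R,
  [/\ unique (fun v : bcType R =>
        [/\ profile_solution Gamma (mu K p) v, `|v| <= 1
          & bigO_pow (p + eps) (fun x => v x - u0 x)]) w,
      forall x, 0 <= x -> u t (x * expR (- mu K p * t)) @[t --> +oo] --> w x,
      forall M : R,
        {uniform `[0, M], (fun (t x : R) => u t (x * expR (- mu K p * t)))
           @ +oo --> (w : R -> R)},
      0 < beta
    & exists2 C : R, 0 < C & forall x t, 0 <= x -> 0 <= t ->
        `|u t (x * expR (- mu K p * t)) - w x|
          <= C * (x `^ (p + eps) * expR (- beta * t))].
Proof.
move=> beta; set q := p + eps; set m := mu K p.
have q0 : 0 < q by rewrite addr_gt0.
have pq : p < q by rewrite ltrDl.
(* Both [p] and [q] lie in [(0, p0)], where [mu] strictly decreases. *)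
have mu_lt : mu K q < m.
  have [_ [[_ dec]|[r0 p0E [r00 _ dec _]]]] := hmu.
    by apply: dec => //; rewrite in_itv/= ?andbT.
  move: hpp0 hepsp0; rewrite p0E -EFinB !lte_fin => pr er.
  by apply: dec => //; rewrite in_itv/= ?hp ?q0//= /q; lra.
have b0 : 0 < beta by rewrite mulr_gt0// subr_gt0.
have lamq : fine (lambda K q) < 1 + q * m.
  have -> : fine (lambda K q) = 1 + q * mu K q.
    by rewrite /mu; field; rewrite gt_eqF.
  by rewrite ltrD2l ltr_pM2l.
have [w [sw w1 wu0]] := profile_ex hlambda ha hb hu0 q0 lamq hint.
have pw v : profile_solution Gamma m v -> `|v| <= 1 ->
    pointwise_solution Gamma (fun t => dilate (m * t) v).
  by move=> sv v1; exact: pointwise_solution_dilate.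
have d0 (v : bcType R) x : dilate (m * 0) v x = v x.
  by rewrite dilateE mulr0 expR0 mul1r.
(* In the rescaled variable the orbit of a profile is stationary. *)
have dK (v : bcType R) t x : dilate (m * t) v (x * expR (- m * t)) = v x.
  by rewrite dilateE mulrCA mulNr -expRD subrr expR0 mulr1.
have rate : exists2 C : R, 0 < C & forall x t, 0 <= x -> 0 <= t ->
    `|u t (x * expR (- m * t)) - w x| <= C * (x `^ q * expR (- beta * t)).
  have [C C0 wC] := wu0; exists C => // x t x0 t0.
  rewrite -[w x](dK w t x).
  have := @comparison_rescaled _ _ hlambda _ hb _ _ m q C
    (cauchy_solution_pointwise hu) (pw _ sw w1) q0 _ x t x0 t0.
  apply => y y0.
  by have [-> _ _] := hu; rewrite d0 distrC wC.
have [C C0 uC] := rate.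
exists w; split => //.
(* The rescaled difference of the two orbits is [w x - v x] at every time, yet it is bounded by a
   multiple of [e^{-beta t}], so it vanishes. *)
- split=> // v [sv v1 [Cv Cv0 vC]]; apply: bc_ext => x x0.
  have [Cw Cw0 wC] := wu0.
  apply/eqP; rewrite -subr_eq0 -normr_le0; apply/ler_addgt0Pr => e e0; rewrite add0r.
  have := expR_small ((Cw + Cv) * x `^ q) b0 e0.
  move=> /(@filter_ex _ _ _)[t [t0 /(le_trans _)]]; apply.
  rewrite -(dK w t x) -(dK v t x) -mulrA.
  have := @comparison_rescaled _ _ hlambda _ hb _ _ m q (Cw + Cv)
    (pw _ sw w1) (pw _ sv v1) q0 _ x t x0 t0.
  apply => y y0.
  rewrite !d0 (_ : w y - v y = (w y - u0 y) - (v y - u0 y)); last by ring.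
  by apply: le_trans (ler_normB _ _) _; rewrite mulrDl lerD ?wC ?vC.
- move=> x x0; apply/cvgrPdist_le => e e0.
  apply: filterS (expR_small (C * x `^ q) b0 e0) => t [t0 te].
  by rewrite distrC; apply: le_trans (uC x t x0 t0) _; rewrite mulrA.
- move=> M A /uniform_nbhs[E [entE EA]].
  have /= := entE; rewrite -entourage_ballE => -[e /= e0 eE].
  (* Balls are strict while the decay bound is not, hence [e / 2]. *)
  have e20 : 0 < e / 2 by rewrite divr_gt0.
  apply: filterS (expR_small (C * `|M| `^ q) b0 e20) => t [t0 te]; apply: EA => x /=.
  rewrite in_itv/= => /andP[x0 xM]; apply: eE; rewrite /=/ball/= distrC.
  apply: le_lt_trans (uC x t x0 t0) _; apply: (@le_lt_trans _ _ (e / 2)); last by lra.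
  apply: le_trans te; rewrite mulrA ler_wpM2r ?expR_ge0// ler_wpM2l ?(ltW C0)//.
  by rewrite ge0_ler_powR ?(ltW q0)// ?nnegrE// (le_trans xM)// ler_norm.
Qed.
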